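(* Let $(\Omega_1,\mathcal F_1,P_1)$ and $(\Omega_2,\mathcal F_2,P_2)$ be standard probability spaces, let $\pi:\mathbb R\to\mathbb R/\mathbb Q$ be the canonical projection to reals modulo rationals, and let $f:\Omega_1\to\mathbb R/\mathbb Q$ and $g:\Omega_2\to\mathbb R/\mathbb Q$ be strong $\mathbb R/\mathbb Q$-valued random variables. If $f$ and $g$ are weakly identically distributed, then they are strongly identically distributed.
   Context: $\mathbb R/\mathbb Q=\mathbb R/E$ where $E=\{(x,y)\in\mathbb R^2: x-y\in\mathbb Q\}$. A map $f:\Omega\to\mathbb R/\mathbb Q$ is a strong $\mathbb R/\mathbb Q$-valued random variable if there is a measurable map $Y:\Omega\to\mathbb R$ with $f=\pi\circ Y$ (random variables being identified when equal almost everywhere). Strong random variables $f$ on $\Omega_1$ and $g$ on $\Omega_2$ are weakly identically distributed if $P_1(f\in A)=P_2(g\in A)$ for every $A\subset\mathbb R/\mathbb Q$ such that $\pi^{-1}(A)$ is a Borel subset of $\mathbb R$. They are strongly identically distributed if there is a probability measure $J$ on $\Omega_1\times\Omega_2$ with marginals $P_1,P_2$ such that $f(\omega_1)=g(\omega_2)$ for $J$-almost all $(\omega_1,\omega_2)$. A standard probability space is a Lebesgue–Rokhlin space (isomorphic mod 0 to an interval with Lebesgue measure, a finite or countable collection of atoms, or a combination of both). *)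

(* Defs.v *)
From HB Require Import structures.
From mathcomp Require Import all_boot all_order all_algebra generic_quotient.
From mathcomp Require Import all_classical all_reals all_analysis.
Set Implicit Arguments.
Unset Strict Implicit.
Unset Printing Implicit Defensive.
Import Order.TTheory GRing.Theory Num.Theory.
Import numFieldNormedType.Exports.
Local Open Scope classical_set_scope.
Local Open Scope ring_scope.

Section RmodQ.
Variable R : realType.

Definition diff_rat (x y : R) : bool := `[< exists q : rat, x - y = ratr q >].

Lemma diff_rat_refl : reflexive diff_rat.
Proof. by move=> x; apply/asboolP; exists 0; rewrite subrr rmorph0. Qed.

Lemma diff_rat_sym : symmetric diff_rat.
Proof.
by move=> x y; apply/asboolP/asboolP => -[q xyq]; exists (- q);
  rewrite -opprB xyq rmorphN.
Qed.

Lemma diff_rat_trans : transitive diff_rat.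
Proof.
move=> y x z /asboolP[p xyp] /asboolP[q yzq]; apply/asboolP.
by exists (p + q); rewrite rmorphD -(subrK y x) -addrA xyp yzq.
Qed.

Canonical diff_rat_equiv :=
  EquivRel diff_rat diff_rat_refl diff_rat_sym diff_rat_trans.

Definition RmodQ := {eq_quot diff_rat}%qT.

Definition piQ (x : R) : RmodQ := (\pi_RmodQ x)%qT.

Lemma piQP (x y : R) : piQ x = piQ y <-> exists q : rat, x - y = ratr q.
Proof. by split=> [/eqmodP/asboolP|?]//; apply/eqmodP/asboolP. Qed.

End RmodQ.

Section standard.
Variable R : realType.

(* The real line with the sigma-algebra of Lebesgue (not Borel) measurable
   sets, on which [completed_lebesgue_measure] is defined. *)
Definition lebesgueR : Type :=
  caratheodory_type ((wlength (R := R) idfun)^*)%mu.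
HB.instance Definition _ := Measurable.on lebesgueR.

Lemma measurable_itv_lebesgueR (i : interval R) :
  measurable ([set` i] : set lebesgueR).
Proof. by apply: sub_caratheodory; exact: measurable_itv. Qed.

(* Lebesgue measure on the interval [i], plus an atom of mass [p n] at [x n];
   [p n = 0] is allowed, so as to have finitely many atoms, or none. *)
Definition interval_atoms (i : interval R) (x : nat -> R)
    (p : nat -> {nonneg R}) : {measure set lebesgueR -> \bar R} :=
  measure_add
    (mrestr (@completed_lebesgue_measure R) (measurable_itv_lebesgueR i))
    (mseries (fun n => mscale (p n) (dirac (x n : lebesgueR))) 0).

Definition iso_mod0 d1 d2 (T1 : measurableType d1) (T2 : measurableType d2)
    (mu1 : {measure set T1 -> \bar R}) (mu2 : {measure set T2 -> \bar R}) :=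
  exists (A1 : set T1) (A2 : set T2) (phi : T1 -> T2),
    (measurable A1 /\ mu1 (~` A1) = 0%E) /\
    (measurable A2 /\ mu2 (~` A2) = 0%E) /\
    set_bij A1 A2 phi /\
    measurable_fun A1 phi /\
    (forall B, measurable B -> B `<=` A1 -> measurable (phi @` B)) /\
    (forall B, measurable B -> B `<=` A2 -> mu1 (A1 `&` phi @^-1` B) = mu2 B).

(* Lebesgue-Rokhlin spaces are complete by definition. *)
Definition standard_probability d (T : measurableType d)
    (P : probability T R) :=
  measure_is_complete P /\
  exists (i : interval R) (x : nat -> R) (p : nat -> {nonneg R}),
    injective x /\ (forall n, x n \notin i) /\
    iso_mod0 P (interval_atoms i x p).

End standard.

Section RmodQ_valued.
Variable R : realType.

(* Random variables that are equal almost everywhere are identified, whence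
   the equality almost everywhere. *)
Definition strong_rv d (T : measurableType d) (P : probability T R)
    (f : T -> RmodQ R) :=
  exists Y : T -> R, measurable_fun [set: T] Y /\
    {ae P, forall w, f w = piQ (Y w)}.

Variables (d1 d2 : measure_display).
Variables (T1 : measurableType d1) (T2 : measurableType d2).
Variables (P1 : probability T1 R) (P2 : probability T2 R).
Variables (f : T1 -> RmodQ R) (g : T2 -> RmodQ R).

Definition weakly_identically_distributed :=
  forall A : set (RmodQ R), measurable ((@piQ R) @^-1` A) ->
    P1 (f @^-1` A) = P2 (g @^-1` A).

Definition strongly_identically_distributed :=
  exists J : probability (T1 * T2)%type R,
    [/\ forall A, measurable A -> pushforward J fst A = P1 A,
        forall B, measurable B -> pushforward J snd B = P2 B
      & {ae J, forall w, f w.1 = g w.2}].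

End RmodQ_valued.

(* Main.v *)
Require Import Defs.
From HB Require Import structures.
From mathcomp Require Import all_boot all_order all_algebra.
From mathcomp Require Import all_classical all_reals all_analysis.
From mathcomp Require Import measurable_realfun.
Set Implicit Arguments.
Unset Strict Implicit.
Unset Printing Implicit Defensive.
Import Order.TTheory GRing.Theory Num.Theory.
Import numFieldNormedType.Exports.
Local Open Scope classical_set_scope.
Local Open Scope ring_scope.
Local Open Scope ereal_scope.

(* Let [f = piQ X] and [g = piQ Y] almost everywhere.  The laws of [X] and [Y]
   agree on the Borel sets invariant under rational translations, and a greedy
   exhaustion along an enumeration of the rationals yields a coupling of these
   laws under which the difference of the coordinates is a.s. rational.
   To lift it, identify the second space mod 0 with the line by [Z], and
   realize conditional laws by quantile functions of independent uniform
   variables: [(X, y)] follows the coupling for some [y = H (X, v)], and then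
   [(y, z)] has the law of [(Y, Z)] for some [z = G (y, u)].  The coupling
   sought is the law of [(w, Z^-1 z)]; as [Z^-1] is only measurable up to null
   sets, it is defined through the completion of the law of [(w, z)]. *)

(** * Probabilities from measures of total mass one *)

Section total_mass_one.
Context d (T : measurableType d) (R : realType).
Variable m : {measure set T -> \bar R}.
Hypothesis m1 : m setT = 1.

(** The proof of total mass one is an argument of this alias of [m], so that the structure of a
    probability can be attached to the alias. *)
Let unit_measure of m setT = 1 : set T -> \bar R := m.

HB.instance Definition _ := Measure.on (unit_measure m1).
HB.instance Definition _ :=
  Measure_isProbability.Build _ _ _ (unit_measure m1) m1.

Lemma probabilityW : exists P : probability T R, forall A, P A = m A.
Proof. by exists (unit_measure m1). Qed.

End total_mass_one.

Lemma addIe0 (R : realType) (x y : \bar R) :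
  y \is a fin_num -> y = x + y -> x = 0.
Proof. by move=> fy yE; rewrite -(addeK x fy) -yE subee. Qed.

(** * Images, differences and infima of finite measures *)

Section measure_packing.
Context d d' (T : measurableType d) (T' : measurableType d') (R : realType).

Lemma finite_measureW (m : {measure set T -> \bar R}) : m setT < +oo ->
  exists m' : {finite_measure set T -> \bar R}, forall A, m' A = m A.
Proof.
by move=> moo; exists (mfrestr measurableT moo) => A; rewrite /= /mfrestr /mrestr setIT.
Qed.

Lemma measure_pushforward (m : {measure set T -> \bar R}) (f : T -> T') :
  measurable_fun setT f ->
  exists m' : {measure set T' -> \bar R}, forall A, m' A = m (f @^-1` A).
Proof.
move=> mf.
pose m' : {measure set T' -> \bar R} :=
  measure_function_pushforward__canonical__measure_function_Measure m mf.
by exists m'.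
Qed.

Lemma measureB (a b : {finite_measure set T -> \bar R}) :
  (forall A, measurable A -> b A <= a A) ->
  exists c : {finite_measure set T -> \bar R},
    forall A, measurable A -> a A = c A + b A.
Proof.
move=> ba.
pose n := cadd (charge_of_finite_measure a) (copp (charge_of_finite_measure b)).
(* Domination is known on measurable sets only; [crestr0] gives 0 on the other sets, so that the
   difference is nonnegative on every set. *)
pose n' := crestr0 n measurableT.
have n'0 A : 0 <= n' A.
  rewrite /n' /crestr0; case: ifPn => // /[!inE] mA.
  by rewrite /crestr setIT /n /cadd /copp /charge_of_finite_measure /= sube_ge0 ?ba// fin_num_measure.
pose c : {measure set T -> \bar R} := measure_of_charge n' n'0.
have cE A : measurable A -> c A = a A - b A.
  by move=> mA; rewrite /c/= /measure_of_charge /n' /crestr0 mem_set// /crestr setIT.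
have coo : c setT < +oo.
  by rewrite cE// ltey_eq; apply/orP; left; rewrite fin_numB !fin_num_measure.
have [c' c'E] := finite_measureW coo.
exists c' => A mA; rewrite c'E cE// subeK// fin_num_measure //.
Qed.

(* [l] is the infimum of [a] and [b], read off a Hahn decomposition of [a - b]. *)
Lemma measure_inf (a b : {finite_measure set T -> \bar R}) :
  exists (a' b' l : {finite_measure set T -> \bar R}) (P : set T),
    [/\ measurable P, a' P = 0, b' (~` P) = 0,
       (forall A, measurable A -> a A = a' A + l A) &
       (forall A, measurable A -> b A = b' A + l A)].
Proof.
pose n := cadd (charge_of_finite_measure a) (copp (charge_of_finite_measure b)).
have [P [N [[mP posP] [mN negN] PNT PN0]]] := Hahn_decomposition n.
have NP : ~` N = P.
  apply/seteqP; split=> x; last first.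
    by move=> Px Nx; have : (P `&` N) x by []; rewrite PN0.
  by move=> /= nNx; have : [set: T] x by []; rewrite -PNT => -[].
(* On the positive set [P] of [a - b] the smaller measure is [b]; on the negative set [N] it is
   [a]. *)
pose l0 : {measure set T -> \bar R} := measure_add (mrestr b mP) (mrestr a mN).
have l0E (A : set T) : l0 A = b (A `&` P) + a (A `&` N) by exact: (measure_addE (mrestr b mP) (mrestr a mN) A).
have [l lE] : exists l : {finite_measure set T -> \bar R}, forall A, l A = l0 A.
  apply: finite_measureW; rewrite l0E !setTI.
  by rewrite ltey_eq; apply/orP; left; rewrite fin_numD !fin_num_measure.
have nE A : measurable A -> n A = a A - b A by [].
have splitE (m : {finite_measure set T -> \bar R}) A : measurable A ->
    m A = m (A `&` P) + m (A `&` N).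
  move=> mA; rewrite -{1}(setIT A) -PNT setIUr measureU//; try exact: measurableI.
  by rewrite setIACA setIid PN0 setI0.
have leP A : measurable A -> b (A `&` P) <= a (A `&` P).
  move=> mA; have mAP := measurableI _ _ mA mP.
  by rewrite -sube_ge0 ?fin_num_measure// -nE//; apply: posP.
have leN A : measurable A -> a (A `&` N) <= b (A `&` N).
  move=> mA; have mAN := measurableI _ _ mA mN.
  by rewrite -sube_le0 // -nE//; apply: negN.
have [a' a'E] : exists a' : {finite_measure set T -> \bar R},
    forall A, measurable A -> a A = a' A + l A.
  by apply: measureB => A mA; rewrite lE l0E [leRHS]splitE// leeD2r// leP.
have [b' b'E] : exists b' : {finite_measure set T -> \bar R},
    forall A, measurable A -> b A = b' A + l A.
  by apply: measureB => A mA; rewrite lE l0E [leRHS]splitE// leeD2l// leN.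
(* The set asked for is [N], where [l] coincides with [a]; on its complement [l] coincides with
   [b]. *)
exists a', b', l, N; split=> //.
- have := a'E _ mN; rewrite lE l0E setIC PN0 measure0 add0e setIid.
  by apply: addIe0; exact: fin_num_measure.
- rewrite NP; have := b'E _ mP; rewrite lE l0E setIid PN0 measure0 adde0.
  by apply: addIe0; exact: fin_num_measure.
Qed.
End measure_packing.

(** * Coupling two laws on the line along rational translations *)

Section rational_coupling.
Variable R : realType.

Lemma measurable_addr (c : R) : measurable_fun setT (fun x : R => (x + c)%R).
Proof. exact: measurable_funD. Qed.

(** [measure_inf] is applied to the translate of [a] by [c] and to [b], and the remainder of the
    translate is moved back. The common part [l] sits at the points of arrival: its mass at [y]
    leaves [a] at [y - c]. *)
Lemma shifted_measure_inf (c : R) (a b : {finite_measure set R -> \bar R}) :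
  exists (a' b' l : {finite_measure set R -> \bar R}) (P : set R),
    [/\ measurable P, a' ((fun x => (x + c)%R) @^-1` P) = 0, b' (~` P) = 0,
       (forall A, measurable A -> a A = a' A + l ((fun y => (y - c)%R) @^-1` A)) &
       (forall A, measurable A -> b A = b' A + l A)].
Proof.
have finite_shift (m : {finite_measure set R -> \bar R}) (e : R) :
    exists m' : {finite_measure set R -> \bar R},
      forall A, m' A = m ((fun x => (x + e)%R) @^-1` A).
  have [m1 m1E] := measure_pushforward m (measurable_addr e).
  have [|m' m'E] := @finite_measureW _ _ _ m1.
    by rewrite m1E preimage_setT ltey_eq fin_num_measure.
  by exists m' => A; rewrite m'E m1E.
have [ac acE] := finite_shift a c.
have [a1 [b' [l [P [mP a1P b'P acl bl]]]]] := measure_inf ac b.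
have [a' a'E] := finite_shift a1 (- c)%R.
have shiftK (e : R) (A : set R) :
    (fun x => x + e)%R @^-1` ((fun y => y - e)%R @^-1` A) = A.
  by apply/seteqP; split=> x; rewrite /= addrK.
exists a', b', l, P; split => //.
  rewrite a'E -[RHS]a1P; congr (a1 _).
  by apply/seteqP; split=> x; rewrite /= subrK.
move=> A mA; rewrite a'E -{1}(shiftK c A) -acE acl//.
rewrite -[X in measurable X]setTI; exact: measurable_addr.
Qed.

(** An enumeration of the rationals with repetitions: a number that encodes no rational gives 0. *)
Definition rat_seq (n : nat) : rat := odflt 0%R (unpickle n).

Lemma rat_seqK (q : rat) : rat_seq (pickle q) = q.
Proof. by rewrite /rat_seq pickleK. Qed.

Lemma measurable_rat_diff :
  measurable [set z : R * R | exists q : rat, (z.1 - z.2)%R = ratr q].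
Proof.
rewrite (_ : [set _ | _] =
    \bigcup_n (fun z : R * R => (z.1 - z.2)%R) @^-1` [set ratr (rat_seq n)]).
  apply: bigcupT_measurable => n; rewrite -[X in measurable X]setTI.
  by apply: (measurable_funB measurable_fst measurable_snd).
apply/seteqP; split=> z; last by case=> n _ /= ->; exists (rat_seq n).
by case=> q zq; exists (pickle q) => //=; rewrite rat_seqK.
Qed.

(* At stage [n] as much mass as possible is moved along the translation by the
   [n]-th rational.  What is left over of [mu] and [nu] in the limit is mutually
   singular under all rational translations, hence carried by two disjoint
   invariant sets; it vanishes as [mu] and [nu] agree on these. *)
Lemma rational_coupling (mu nu : probability R R) :
  (forall A : set R, measurable A -> (forall (q : rat) x, A x -> A (x + ratr q)%R) ->
    mu A = nu A) ->
  exists M : probability (R * R)%type R,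
    [/\ forall A, measurable A -> M (fst @^-1` A) = mu A,
        forall A, measurable A -> M (snd @^-1` A) = nu A &
        {ae M, forall z, exists q : rat, (z.1 - z.2)%R = ratr q}].
Proof.
move=> munu.
pose FM := {finite_measure set R -> \bar R}.
pose q n : R := ratr (rat_seq n).
(* A stage takes its index and the two measures still to be matched; choosing its outcome as a
   function of these makes the construction a plain recursion. *)
have step (s : nat * (FM * FM)) : exists t : FM * FM * FM * set R,
   [/\ measurable t.2, t.1.1.1 ((fun x => (x + q s.1)%R) @^-1` t.2) = 0,
       t.1.1.2 (~` t.2) = 0,
       (forall A, measurable A ->
         s.2.1 A = t.1.1.1 A + t.1.2 ((fun y => (y - q s.1)%R) @^-1` A)) &
       (forall A, measurable A -> s.2.2 A = t.1.1.2 A + t.1.2 A)].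
  have [a' [b' [l [P H]]]] := shifted_measure_inf (q s.1) s.2.1 s.2.2.
  by exists (a', b', l, P).
have [F FP] := choice step.
(* [st n] holds the parts of [mu] and [nu] that are unmatched before stage [n]. *)
pose st := fix st n : FM * FM :=
  if n is k.+1 then (F (k, st k)).1.1 else (mu : FM, nu : FM).
pose l n : FM := (F (n, st n)).1.2.
pose P n := (F (n, st n)).2.
have mP n : measurable (P n) by have [] := FP (n, st n).
have st1P n : (st n.+1).1 ((fun x => (x + q n)%R) @^-1` P n) = 0.
  by have [] := FP (n, st n).
have st2P n : (st n.+1).2 (~` P n) = 0 by have [] := FP (n, st n).
(* The mass [l n] is placed on the line of the pairs [(y - q n, y)], whose coordinates differ by a
   rational. *)
have [J JE] : exists J : nat -> {measure set (R * R) -> \bar R},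
    forall n A, J n A = l n ((fun y => ((y - q n)%R, y)) @^-1` A).
  suff /choice[J JE] : forall n, exists J : {measure set (R * R) -> \bar R},
    forall A, J A = l n ((fun y => ((y - q n)%R, y)) @^-1` A) by exists J.
  move=> n; apply: measure_pushforward; apply: measurable_fun_pair => //.
  exact: measurable_addr.
pose M0 : {measure set (R * R) -> \bar R} := mseries J 0.
have M0E A : M0 A = \sum_(0 <= k <oo) J k A by [].
have J1E n A : J n (fst @^-1` A) = l n ((fun y => (y - q n)%R) @^-1` A).
  by rewrite JE.
have J2E n A : J n (snd @^-1` A) = l n A by rewrite JE.
have st1E n A : measurable A ->
    mu A = (st n).1 A + \sum_(0 <= k < n) J k (fst @^-1` A).
  move=> mA; elim: n => [|n IH]; first by rewrite big_geq// adde0.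
  rewrite IH; have -> : (st n).1 A = (st n.+1).1 A + J n (fst @^-1` A).
    by rewrite J1E; have [_ _ _ /(_ _ mA)/= ->] := FP (n, st n).
  by rewrite big_nat_recr//= -addeA; congr (_ + _); exact: addeC.
have st2E n A : measurable A ->
    nu A = (st n).2 A + \sum_(0 <= k < n) J k (snd @^-1` A).
  move=> mA; elim: n => [|n IH]; first by rewrite big_geq// adde0.
  rewrite IH; have -> : (st n).2 A = (st n.+1).2 A + J n (snd @^-1` A).
    by rewrite J2E; have [_ _ _ _ /(_ _ mA)/= ->] := FP (n, st n).
  by rewrite big_nat_recr//= -addeA; congr (_ + _); exact: addeC.
have M0le (D : set (R * R)) y :
    (forall n, \sum_(0 <= k < n) J k D <= y) -> M0 D <= y.
  move=> H; rewrite M0E; apply: lime_le; first exact: is_cvg_nneseries.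
  exact: nearW.
have partial_le (p : R * R -> R) (A : set R) n :
    \sum_(0 <= k < n) J k (p @^-1` A) <= M0 (p @^-1` A).
  by rewrite M0E; apply: nneseries_lim_ge.
have M0mu A : measurable A -> M0 (fst @^-1` A) <= mu A.
  by move=> mA; apply: M0le => n; rewrite (st1E n)// leeDr.
have M0nu A : measurable A -> M0 (snd @^-1` A) <= nu A.
  by move=> mA; apply: M0le => n; rewrite (st2E n)// leeDr.
have marginal (p : R * R -> R) : measurable_fun setT p ->
    M0 setT < +oo ->
    exists m : FM, forall A, m A = M0 (p @^-1` A).
  move=> mp Moo; have [m1 m1E] := measure_pushforward M0 mp.
  have [|m mE] := @finite_measureW _ _ _ m1; first by rewrite m1E preimage_setT.
  by exists m => A; rewrite mE m1E.
have M0oo : M0 setT < +oo.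
  rewrite -(preimage_setT fst) (le_lt_trans (M0mu _ measurableT))//.
  by rewrite ltey_eq fin_num_measure.
have [M1 M1E] := marginal _ measurable_fst M0oo.
have [M2 M2E] := marginal _ measurable_snd M0oo.
have [mu' mu'E] : exists c : FM, forall A, measurable A -> mu A = c A + M1 A.
  by apply: measureB => A mA; rewrite M1E M0mu.
have [nu' nu'E] : exists c : FM, forall A, measurable A -> nu A = c A + M2 A.
  by apply: measureB => A mA; rewrite M2E M0nu.
(* The limiting remainder is at most the remainder after stage [n], which vanishes on this set:
   adding [M1 A] to both sides turns the claim into a comparison of a partial sum with its
   series. *)
have mu'P n : mu' ((fun x => (x + q n)%R) @^-1` P n) = 0.
  set A := _ @^-1` _.
  have mA : measurable A.
    rewrite -[X in measurable X]setTI; exact: measurable_addr.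
  apply/eqP; rewrite -measure_le0 -(@leeD2rE _ (M1 A)) ?fin_num_measure//.
  rewrite add0e -mu'E// (st1E n.+1)// st1P add0e M1E; exact: partial_le.
have nu'P n : nu' (~` P n) = 0.
  have mA := measurableC (mP n).
  apply/eqP; rewrite -measure_le0 -(@leeD2rE _ (M2 (~` P n))) ?fin_num_measure//.
  rewrite add0e -nu'E// (st2E n.+1)// st2P add0e M2E; exact: partial_le.
(* [B] carries [nu'], and [S] is its saturation under rational translations. Each translate of [B]
   that makes up [S] lies in a [mu']-null set, so [S] carries [nu'] and is [mu']-null. *)
pose B := \bigcap_n P n.
pose S := \bigcup_n ((fun x => (x + q n)%R) @^-1` B).
have mB : measurable B by exact: bigcapT_measurable.
have mS : measurable S.
  apply: bigcupT_measurable => n; rewrite -[X in measurable X]setTI.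
  exact: measurable_addr.
have Sinv (r : rat) x : S x -> S (x + ratr r)%R.
  case=> n _ /= Bx; exists (pickle (rat_seq n - r)%R) => //=.
  by rewrite /q rat_seqK rmorphB/= addrA addrAC addrK.
have BS : B `<=` S.
  by move=> x Bx; exists (pickle (0%R : rat)) => //=; rewrite /q rat_seqK rmorph0 addr0.
have mu'S : mu' S = 0.
  apply/negligibleP => //; apply: negligible_bigcup => n.
  apply: (@negligibleS _ _ _ _ ((fun x => (x + q n)%R) @^-1` P n)).
    by move=> x /= Bx; apply: Bx.
  apply/negligibleP; last exact: mu'P.
  by rewrite -[X in measurable X]setTI; exact: measurable_addr.
have nu'S : nu' (~` S) = 0.
  apply/negligibleP => //; first exact: measurableC.
  apply: (@negligibleS _ _ _ _ (~` B)); first exact: subsetC.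
  rewrite setC_bigcap; apply: negligible_bigcup => n.
  by apply/negligibleP; [exact: measurableC|exact: nu'P].
(* Rational translations preserve [S], so each [J i] gives the same mass to both cylinders over
   [S]. *)
have M12S : M1 S = M2 S.
  rewrite M1E M2E !M0E; apply: eq_eseriesr => i _; rewrite J1E J2E; congr (l i _).
  apply/seteqP; split=> x /=; last first.
    by move=> /(Sinv (- rat_seq i)%R); rewrite rmorphN.
  by move=> /(Sinv (rat_seq i)%R); rewrite subrK.
(* Here the agreement of [mu] and [nu] on invariant sets enters: the moved masses being equal, the
   remainders agree on [S]. *)
have nu'S0 : nu' S = 0.
  have := munu _ mS Sinv; rewrite mu'E// mu'S add0e nu'E// M12S.
  by apply: addIe0; exact: fin_num_measure.
have nu'T : nu' setT = 0.
  have -> : nu' setT = nu' S + nu' (~` S).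
    by rewrite -(setUv S) measureU ?setICr//; exact: measurableC.
  by rewrite nu'S0 nu'S adde0.
have nuT A : measurable A -> nu A = M2 A.
  move=> mA; rewrite nu'E//; suff -> : nu' A = 0 by rewrite add0e.
  by apply/eqP; rewrite -measure_le0 -nu'T le_measure ?inE.
(* As [nu'] vanishes, the moved mass is 1, which in turn forces [mu'] to vanish. *)
have M0T : M0 setT = 1.
  by rewrite -(preimage_setT snd) -M2E -nuT// probability_setT.
have mu'T : mu' setT = 0.
  apply: (@addIe0 _ _ (M1 setT)); first exact: fin_num_measure.
  by rewrite -mu'E// probability_setT M1E preimage_setT.
have muT A : measurable A -> mu A = M1 A.
  move=> mA; rewrite mu'E//; suff -> : mu' A = 0 by rewrite add0e.
  by apply/eqP; rewrite -measure_le0 -mu'T le_measure ?inE.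
have [M ME] := probabilityW M0T.
exists M; split.
- by move=> A mA; rewrite ME muT// M1E.
- by move=> A mA; rewrite ME nuT// M2E.
apply/negligibleP; first by apply: measurableC; exact: measurable_rat_diff.
apply: (etrans (ME _)); rewrite M0E eseries0// => n _ _; rewrite JE.
rewrite (_ : _ @^-1` _ = set0) ?measure0// -subset0 => x /=; apply.
by exists (- rat_seq n)%R; rewrite rmorphN/= addrAC subrr add0r.
Qed.

End rational_coupling.

(** * The uniform law on the unit interval *)

Section uniform.
Variable R : realType.

(** Half-lines with endpoint in [0, 1] are enough: they turn a value of a distribution function into
    a probability in [measure_undergraph]. *)
Lemma uniform_law : exists U : probability R R,
  forall c : R, (0 <= c <= 1)%R -> U `]-oo, c[%classic = c%:E.
Proof.
have mid : measurable_fun [set: measurableTypeR R] (idfun : measurableTypeR R -> R).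
  by move=> _ Y mY; rewrite setTI.
have [m mE] := measure_pushforward (uniform_prob (@ltr01 R)) mid.
have [|U UE] := @probabilityW _ _ _ m; first by rewrite mE preimage_setT; exact: probability_setT.
exists U => c /andP[c0 c1].
rewrite UE mE preimage_id; apply: etrans (integral_uniform_pdf _ _ _) _.
rewrite (_ : _ `&` _ = `[0%R, c[%classic); last first.
  apply/seteqP; split=> x /=; rewrite !in_itv/=.
    by move=> [-> /andP[-> _]].
  by move=> /andP[x0 xc]; rewrite xc x0 (le_trans (ltW xc)).
rewrite (eq_integral (cst 1)); last first.
  move=> x; rewrite inE/= in_itv/= => /andP[x0 xc].
  by rewrite /uniform_pdf x0 (le_trans (ltW xc))//= subr0 invr1.
rewrite integral_cst// mul1e; apply: etrans (lebesgue_measure_itv _) _.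
rewrite /= lte_fin.
case: ltP => [_|]; first by rewrite -EFinD subr0.
by move=> c0'; congr _%:E; apply/eqP; rewrite eq_le c0 c0'.
Qed.

End uniform.

(** * Equality of measures modulo null sets and on products *)

Section measure_ext.
Context d (T : measurableType d) (R : realType).

Lemma measure_eq_mod (m : {measure set T -> \bar R}) X Y N :
  measurable X -> measurable Y -> m.-negligible N ->
  X `<=` Y `|` N -> Y `<=` X `|` N -> m X = m Y.
Proof.
wlog suff H : X Y / measurable X -> measurable Y -> m.-negligible N ->
    X `<=` Y `|` N -> m X <= m Y.
  by move=> mX mY N0 XY YX; apply/eqP; rewrite eq_le !H.
move=> mX mY [N' [mN' N'0 NN']] XY.
have -> : m Y = m (Y `|` N').
  apply/eqP; rewrite eq_le le_measure ?inE//=; last exact: measurableU.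
  rewrite (le_trans (measureU2 _ _ _))//= ?adde0//.
  by rewrite N'0 adde0.
rewrite le_measure ?inE//; first exact: measurableU.
by apply: (subset_trans XY); exact: setUS.
Qed.

(** Uniqueness of measures on a generating class closed under intersection is used twice: for fixed
    [B] the half-lines generate the Borel sets, and then the rectangles generate the product
    sigma-algebra. *)
Lemma finite_measure_prod_ext (m1 m2 : {finite_measure set (T * R)%type -> \bar R}) :
  (forall B (r : R), measurable B ->
    m1 (B `*` `]-oo, r[%classic) = m2 (B `*` `]-oo, r[%classic)) ->
  forall S, measurable S -> m1 S = m2 S.
Proof.
move=> m12.
have m12X B C : measurable B -> measurable C -> m1 (B `*` C) = m2 (B `*` C).
  move=> mB mC.
  have mBT : measurable (B `*` [set: R]) by exact: measurableX.
  have slice (m : {finite_measure set (T * R)%type -> \bar R}) :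
      exists s : {measure set R -> \bar R}, forall D, s D = m (B `*` D).
    have [s sE] := measure_pushforward (mrestr m mBT) measurable_snd.
    exists s => D; rewrite sE /mrestr; congr (m _).
    by apply/seteqP; split=> [[x y] [/= Dy [Bx _]]|[x y] [/= Bx Dy]].
  have [s1 s1E] := slice m1; have [s2 s2E] := slice m2.
  rewrite -s1E -s2E.
  apply: (measure_unique [set A | exists x : R, A = `]-oo, x[%classic]
    (fun n : nat => `]-oo, (n%:R : R)[%classic)) => //.
  - exact: RGenInftyO.measurableE.
  - move=> _ _ [x ->] [y ->]; exists (Num.min x y).
    apply/seteqP; split=> z /=; rewrite !in_itv/= lt_min; first by move=> [-> ->].
    by move=> /andP[].
  - by move=> n; exists n%:R.
  - apply/seteqP; split=> // x _; exists (Num.truncn x).+1 => //=.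
    rewrite in_itv/=; exact: truncnS_gt.
  - by move=> A [x ->]; rewrite s1E s2E m12.
  - by move=> k; rewrite s1E ltey_eq fin_num_measure//; exact: measurableX.
pose G : set (set (T * R)) :=
  [set C | exists A, measurable A /\ exists B, measurable B /\ C = A `*` B].
move=> S mS; apply: (measure_unique G (fun=> setT)) => //.
- rewrite measurable_prod_measurableType //; congr (<<s _ >>).
  rewrite predeqE => C; split => [[A mA [B mB <-]]|[A [mA [B [mB ->]]]]].
    by exists A; split => //; exists B.
  by exists A => //; exists B.
- move=> _ _ [X1 [mX1 [X2 [mX2 ->]]]] [Y1 [mY1 [Y2 [mY2 ->]]]].
  rewrite -setXI; exists (X1 `&` Y1); split; first exact: measurableI.
  by exists (X2 `&` Y2); split => //; exact: measurableI.
- move=> _; exists setT; split => //; exists setT; split => //.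
  by rewrite setXTT.
- by rewrite bigcup_const//; exists 0%N.
- by move=> _ [A [mA [B [mB ->]]]]; exact: m12X.
- by move=> _; rewrite ltey_eq fin_num_measure.
Qed.

End measure_ext.

(** * Densities with values in the unit interval, and their undergraphs *)

Section conditional_density.
Context d (T : measurableType d) (R : realType).

(** The difference [f - g] is positive on [D] but has nonpositive integral, so it is zero almost
    everywhere on [D]; this is possible only if [D] is null. *)
Lemma lt_integral_null (m : {measure set T -> \bar R}) (D : set T)
    (f g : T -> \bar R) : measurable D ->
  m.-integrable D f -> m.-integrable D g ->
  (forall x, D x -> g x < f x) ->
  \int[m]_(x in D) f x <= \int[m]_(x in D) g x -> m D = 0.
Proof.
move=> mD fi gi gf fg.
have fgi : m.-integrable D (f \- g) by exact: integrableB.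
have fg_gt0 x : D x -> 0 < (f \- g) x by move=> Dx; rewrite sube_gt0 gf.
have fg0 : \int[m]_(x in D) `|(f \- g) x| = 0.
  rewrite (eq_integral (f \- g)); last first.
    by move=> x /[!inE] Dx; rewrite gee0_abs// ltW// fg_gt0.
  apply/eqP; rewrite eq_le integral_ge0 ?andbT; last first.
    by move=> x Dx; rewrite ltW// fg_gt0.
  by rewrite integralB// sube_le0.
have [N [mN N0 DN]] := (ae_eq_integral_abs m mD (measurable_int _ fgi)).1 fg0.
apply/eqP; rewrite -measure_le0 -N0 le_measure ?inE// => x Dx; apply: DN => /=.
by move=> /(_ Dx) fgx0; have := fg_gt0 _ Dx; rewrite [X in _ < X]fgx0 ltxx.
Qed.

(** The density is a Radon-Nikodym derivative. As [n] is at most [m], it exceeds 1 only on a null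
    set, and truncating it at 1 makes the bounds hold at every point. *)
Lemma conditional_density (m n : {finite_measure set T -> \bar R}) :
  (forall A, measurable A -> n A <= m A) ->
  exists g : T -> R, [/\ measurable_fun setT g,
    forall x, (0 <= g x <= 1)%R &
    forall A, measurable A -> n A = \int[m]_(x in A) (g x)%:E].
Proof.
move=> nm.
have dom : n `<< m.
  apply/null_content_dominatesP => A mA mA0.
  by apply/eqP; rewrite -measure_le0 -mA0 nm.
have [f [f0 fi fE]] := radon_nikodym_finite dom.
have mf := measurable_int _ fi.
pose D := [set x | 1 < f x].
have mD : measurable D.
  by rewrite -[D]setTI; apply: measurable_lte => //; exact: measurable_cst.
have mD0 : m D = 0.
  apply: (@lt_integral_null _ _ f (cst 1)) => //.
  - exact: integrableS fi.
  - apply/integrableP; split; first exact: measurable_cst.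
    rewrite (eq_integral (cst 1)); last by move=> x _; rewrite gee0_abs.
    by rewrite integral_cst// mul1e ltey_eq fin_num_measure.
  - by rewrite -fE// integral_cst// mul1e nm.
pose g x := fine (mine (f x) 1).
have gE x : (g x)%:E = mine (f x) 1.
  rewrite /g fineK// ge0_fin_numE; last by rewrite le_min f0 lee01.
  by rewrite (le_lt_trans _ (ltry 1))// ge_min lexx orbT.
have mg : measurable_fun setT g.
  apply/measurable_EFinP; rewrite (_ : _ \o _ = fun x => mine (f x) (cst 1 x)).
    by apply: measurable_mine => //; exact: measurable_cst.
  by apply/funext => x; rewrite /= gE.
exists g; split => //.
- by move=> x; rewrite -2!lee_fin gE le_min f0 lee01 ge_min lexx orbT.
- move=> A mA; rewrite fE//; apply: ae_eq_integral => //.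
  + exact: measurable_funTS.
  + by apply: measurable_funTS; exact/measurable_EFinP.
  exists D; split => // x /= /not_implyP[Ax]; rewrite gE => fg.
  by rewrite /D /= ltNge; apply/negP => f1; apply: fg; rewrite min_l.
Qed.

(** The section at a point [x] of [B] is the half-line below [g x], of mass [g x] under [U]; it
    remains to integrate over [x]. *)
Lemma measure_undergraph (m : probability T R) (U : probability R R)
    (B : set T) (g : T -> R) :
  (forall c : R, (0 <= c <= 1)%R -> U `]-oo, c[%classic = c%:E) ->
  measurable B -> measurable_fun setT g -> (forall x, (0 <= g x <= 1)%R) ->
  (m \x U) [set z | B z.1 /\ (z.2 < g z.1)%R] = \int[m]_(x in B) (g x)%:E.
Proof.
move=> UE mB mg g01; rewrite /product_measure1 [RHS]integral_mkcond.
apply: eq_integral => x _; rewrite patchE /=.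
case: ifPn => [/set_mem Bx|/negP nBx].
  rewrite -UE//; congr (U _); rewrite /xsection; apply/seteqP; split=> y /=.
    by rewrite in_itv/= inE => -[].
  by rewrite in_itv/= inE.
rewrite (_ : xsection _ _ = set0) ?measure0//.
by apply/seteqP; split=> y //=; rewrite /xsection/= inE/= => -[Bx _]; apply: nBx; rewrite inE.
Qed.

End conditional_density.

Lemma measurable_ltr_set d (T : measurableType d) (R : realType) (f g : T -> R) :
  measurable_fun setT f -> measurable_fun setT g ->
  measurable [set x | (f x < g x)%R].
Proof.
move=> mf mg; have := measurable_fun_ltr mf mg.
by move=> /(_ measurableT [set true] I); rewrite setTI.
Qed.

(** * Realization of conditional laws by quantile functions *)

Section transfer.
Context d (T : measurableType d) (R : realType).

(* [G (x, _)] is the quantile function of the conditional law under [M] of the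
   second coordinate given that the first one is [x]; the conditional
   distribution function is [g _ x]. *)
Lemma transfer (m : probability T R) (U : probability R R)
    (M : probability (T * R)%type R) :
  (forall c : R, (0 <= c <= 1)%R -> U `]-oo, c[%classic = c%:E) ->
  (forall A, measurable A -> M (fst @^-1` A) = m A) ->
  exists G : T * R -> R, measurable_fun setT G /\
    forall S, measurable S -> (m \x U) ((fun z => (z.1, G z)) @^-1` S) = M S.
Proof.
move=> UE Mm.
have [nu nuE] : exists nu : R -> {finite_measure set T -> \bar R},
    forall r A, nu r A = M (A `*` `]-oo, r[%classic).
  suff /choice[nu nuE] : forall r : R, exists nu : {finite_measure set T -> \bar R},
    forall A, nu A = M (A `*` `]-oo, r[%classic) by exists nu.
  move=> r; have mr : measurable (setT `*` `]-oo, r[%classic : set (T * R)).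
    exact: measurableX.
  have [n nE] := measure_pushforward (mrestr M mr) measurable_fst.
  have [|n' n'E] := @finite_measureW _ _ _ n.
    by rewrite nE /= /mrestr preimage_setT ltey_eq fin_num_measure//; exact: measurableI.
  exists n' => A; rewrite n'E nE /mrestr; congr (M _).
  by apply/seteqP; split=> [[x y] [/= Ax [_ yr]]|[x y] [/= Ax yr]].
have num r A : measurable A -> nu r A <= m A.
  move=> mA; rewrite nuE -Mm// le_measure ?inE//.
  - exact: measurableX.
  - by rewrite -[X in measurable X]setTI; exact: measurable_fst.
  - by move=> [x y] [].
have [g gP] := choice (fun r => @conditional_density _ _ _ m (nu r) (num r)).
have mg r : measurable_fun setT (g r) by have [] := gP r.
have g01 r x : (0 <= g r x <= 1)%R by have [_ /(_ x)] := gP r.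
have gE r A : measurable A -> nu r A = \int[m]_(x in A) (g r x)%:E.
  by have [_ _] := gP r; exact.
have gi r A : measurable A -> m.-integrable A (EFin \o g r).
  move=> mA; apply/integrableP; split.
    by apply: measurable_funTS; exact/measurable_EFinP.
  rewrite (eq_integral (fun x => (g r x)%:E)); last first.
    by move=> x _ /=; have /andP[g0 _] := g01 r x; rewrite ger0_norm.
  by rewrite -gE// ltey_eq fin_num_measure.
have nu_le r s A : (r <= s)%R -> measurable A -> nu r A <= nu s A.
  move=> rs mA; rewrite !nuE le_measure ?inE//; try exact: measurableX.
  move=> [x y] [/= Ax]; rewrite !in_itv/= => yr; split => //=.
  by rewrite (lt_le_trans yr).
have mlt r s : measurable [set x | (g s x < g r x)%R].
  exact: measurable_ltr_set.
(* Each [g r] is determined up to a null set only, so monotonicity in [r] holds almost everywhere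
   for each pair of parameters. *)
have g_mono r s : (r <= s)%R -> m [set x | (g s x < g r x)%R] = 0.
  move=> rs; apply: (@lt_integral_null _ _ _ _ _ (EFin \o g r) (EFin \o g s)).
  - exact: mlt.
  - exact: gi.
  - exact: gi.
  - by move=> x /=; rewrite lte_fin.
  - by rewrite -!gE//; exact: nu_le.
pose q n : R := ratr (rat_seq n).
pose V : probability (T * R)%type R := m \x U.
pose E n := [set z : T * R | (z.2 < g (q n) z.1)%R].
have mE r : measurable [set z : T * R | (z.2 < g r z.1)%R].
  apply: measurable_ltr_set; first exact: measurable_snd.
  by apply: (measurableT_comp (mg r)); exact: measurable_fst.
(* [A r] will be the event that the quantile function is below [r]. This union over rationals
   increases with [r] at every point and involves only countably many conditional distribution
   functions. *)
pose A r := \bigcup_(n in [set n | (q n < r)%R]) E n.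
have mA r : measurable (A r) by apply: bigcup_measurable => n _; exact: mE.
have mBT (B : set T) : measurable B -> measurable (B `*` [set: R]).
  by move=> mB; exact: measurableX.
have VB r B : measurable B ->
    V ((B `*` setT) `&` [set z : T * R | (z.2 < g r z.1)%R]) = nu r B.
  move=> mB; rewrite gE// -(measure_undergraph m UE mB (mg r) (g01 r)).
  by congr (V _); apply/seteqP; split=> [[x y] [[/= ? _] ?]|[x y] [/= ? ?]].
have VA r B : measurable B -> V ((B `*` setT) `&` A r) = nu r B.
  move=> mB; apply/eqP; rewrite eq_le; apply/andP; split.
    (* Upper bound: off the points where monotonicity fails between [r] and a smaller rational,
       [A r] lies under the graph of [g r]. *)
    pose N := \bigcup_(n in [set n | (q n < r)%R]) [set x | (g r x < g (q n) x)%R].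
    have mN : measurable N by apply: bigcup_measurable => n _; exact: mlt.
    have N0 : m N = 0.
      apply/negligibleP => //; rewrite /N bigcup_mkcond.
      apply: negligible_bigcup => n; case: ifPn => [/set_mem/= qr|_].
        by apply/negligibleP; [exact: mlt|exact/g_mono/ltW].
      exact: negligible_set0.
    apply: (@le_trans _ _ (V (((B `*` setT) `&` [set z : T * R | (z.2 < g r z.1)%R])
        `|` (N `*` setT)))).
      rewrite le_measure ?inE//.
      - by apply: measurableI => //; exact: mBT.
      - by apply: measurableU; [apply: measurableI => //; exact: mBT|exact: mBT].
      move=> [x y] [[/= Bx _]] [n /= qr yq].
      have [yr|ry] := ltP y (g r x); [by left|right; split => //=].
      by exists n => //=; exact: le_lt_trans ry yq.
    apply: le_trans; first apply: measureU2.
    - by apply: measurableI => //; exact: mBT.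
    - exact: mBT.
    rewrite -[leRHS]adde0; apply: leeD; first by rewrite -VB.
    rewrite [leLHS](_ : _ = m N * U setT); first by rewrite N0 mul0e.
    exact: product_measure1E.
  (* Lower bound: a rational between [s] and [r] has its undergraph inside [A r]. Then [s] increases
     to [r], and the half-lines being open, their masses converge to [nu r B]. *)
  have lb s : (s < r)%R -> nu s B <= V ((B `*` setT) `&` A r).
    move=> /rat_in_itvoo[p]; rewrite in_itv/= => /andP[sp pr].
    rewrite (le_trans (nu_le _ _ _ (ltW sp) mB))// -VB// le_measure ?inE//.
    - by apply: measurableI => //; exact: mBT.
    - by apply: measurableI => //; exact: mBT.
    apply: setIS => z /= zp; exists (pickle p) => /=; first by rewrite /q rat_seqK.
    by rewrite /E /= /q rat_seqK.
  pose F n := B `*` `]-oo, (r - n.+1%:R^-1)%R[%classic : set (T * R).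
  have FU : B `*` `]-oo, r[%classic = \bigcup_n F n.
    apply/seteqP; split=> [[x y] [/= Bx]|[x y] [n _ [/= Bx]]]; rewrite !in_itv/=.
      move=> yr; have : (0 < r - y)%R by rewrite subr_gt0.
      move=> /ltr_add_invr[k]; rewrite add0r => kry; exists k => //; split => //=.
      by rewrite in_itv/= ltrBrDr addrC -ltrBrDr.
    by move=> yr; split => //; rewrite (lt_trans yr)// ltrBlDr ltrDl.
  have mF n : measurable (F n) by exact: measurableX.
  have FV : M (F n) @[n --> \oo] --> nu r B.
    rewrite nuE FU; apply: nondecreasing_cvg_mu => //.
      exact: bigcupT_measurable.
    move=> i j ij; apply/subsetPset => [[x y]] [/= Bx]; rewrite !in_itv/= => yi.
    split => //=; rewrite ?in_itv/= (lt_le_trans yi)// lerD2l lerN2.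
    by rewrite lef_pV2 ?posrE// ler_nat.
  rewrite -(cvg_lim _ FV)//; apply: lime_le; first by apply/cvg_ex; exists (nu r B).
  by apply: nearW => n; rewrite /F -nuE lb// ltrBlDr ltrDl.
(* The generalized inverse over rational levels. An infimum is below [r] exactly when some member
   is, so the strict sublevel sets are the [A r], without exceptional points. *)
pose G0 z := ereal_inf [set (q n)%:E | n in [set n | E n z]].
have G0E r z : (G0 z < r%:E) = `[< A r z >].
  apply/idP/asboolP.
    by move=> /ereal_inf_ltP[_ [n /= Enz <-]]; rewrite lte_fin => qr; exists n.
  by move=> [n /= qr Enz]; apply/ereal_inf_ltP; exists (q n)%:E; [exists n|rewrite lte_fin].
have AG0 r : A r = [set z | G0 z < r%:E].
  by apply/seteqP; split=> z /=; rewrite G0E; [move=> ?; apply/asboolP|move/asboolP].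
have mG0 : measurable_fun setT G0.
  apply: (measurability _ (ErealGenInftyO.measurableE R)) => //.
  move=> _ [_ [x ->] <-]; rewrite setTI (_ : _ @^-1` _ = A x)//.
(* [fine] sends infinite values to 0, which is harmless: [V (A r)] tends to 1 and to 0 at plus and
   minus infinity, so infinite values have probability zero. *)
pose G := fine \o G0.
have mG : measurable_fun setT G by exact: measurableT_comp.
have Ale r s : (r <= s)%R -> A r `<=` A s.
  by move=> rs z [n /= qr Enz]; exists n => //=; exact: lt_le_trans rs.
have VAE r : V (A r) = M (setT `*` `]-oo, r[%classic).
  by rewrite -nuE -VA// setXTT setTI.
have mTr r : measurable (setT `*` `]-oo, r[%classic : set (T * R)).
  exact: measurableX.
have Ny : V.-negligible [set z | G0 z = +oo].
  exists (~` \bigcup_(n : nat) A n%:R); split.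
  - by apply: measurableC; apply: bigcupT_measurable => n.
  - rewrite probability_setC; last by apply: bigcupT_measurable => n.
    suff -> : V (\bigcup_(n : nat) A n%:R) = 1 by rewrite subee.
    have /cvg_lim <- // : V (A n%:R) @[n --> \oo] --> V (\bigcup_n A n%:R).
      apply: nondecreasing_cvg_mu => //; first exact: bigcupT_measurable.
      by move=> i j ij; apply/subsetPset/Ale; rewrite ler_nat.
    under eq_fun do rewrite VAE.
    apply/cvg_lim => //; rewrite -(probability_setT M).
    rewrite (_ : setT = \bigcup_(n : nat) (setT `*` `]-oo, (n%:R : R)[%classic)).
      apply: nondecreasing_cvg_mu => //; first exact: bigcupT_measurable.
      move=> i j ij; apply/subsetPset => -[x y] [/= _]; rewrite in_itv/= => yi.
      by split => //=; rewrite in_itv/= (lt_le_trans yi)// ler_nat.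
    apply/seteqP; split=> // -[x y] _; exists (Num.truncn y).+1 => //=.
    by split => //=; rewrite in_itv/=; exact: truncnS_gt.
  - by move=> z /= Gz [n _]; rewrite AG0/= Gz.
have NNy : V.-negligible [set z | G0 z = -oo].
  exists (\bigcap_(n : nat) A (- n%:R)%R); split.
  - by apply: bigcapT_measurable => n.
  - have /cvg_lim <- // : V (A (- n%:R)%R) @[n --> \oo] --> V (\bigcap_n A (- n%:R)%R).
      apply: nonincreasing_cvg_mu => //.
      + by rewrite ltey_eq fin_num_measure.
      + exact: bigcapT_measurable.
      + by move=> i j ij; apply/subsetPset/Ale; rewrite lerN2 ler_nat.
    under eq_fun do rewrite VAE.
    apply/cvg_lim => //; rewrite -(measure0 M).
    rewrite (_ : set0 = \bigcap_(n : nat) (setT `*` `]-oo, (- n%:R : R)%R[%classic)).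
      apply: nonincreasing_cvg_mu => //.
      + by rewrite ltey_eq fin_num_measure.
      + exact: bigcapT_measurable.
      move=> i j ij; apply/subsetPset => -[x y] [/= _]; rewrite in_itv/= => yi.
      by split => //=; rewrite in_itv/= (lt_le_trans yi)// lerN2 ler_nat.
    apply/esym; rewrite -subset0 => -[x y] /(_ (Num.truncn (- y)%R).+1 I) [_ /=].
    by rewrite in_itv/= ltrNr ltNge (ltW (truncnS_gt _)).
  - by move=> z /= Gz n _; rewrite AG0/= Gz ltNyr.
have [W WE] := measure_pushforward V (measurable_fun_pair measurable_fst mG).
have [|W' W'E] := @finite_measureW _ _ _ W.
  by rewrite WE preimage_setT ltey_eq fin_num_measure.
exists G; split => // S mS; rewrite -[LHS]WE -W'E.
apply: finite_measure_prod_ext mS => B r mB; rewrite W'E WE.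
transitivity (nu r B); last by rewrite nuE.
rewrite -VA//; apply: measure_eq_mod (negligibleU Ny NNy) _ _.
- have := measurable_fun_pair measurable_fst mG.
  by move=> /(_ measurableT (B `*` `]-oo, r[%classic)); rewrite setTI; apply; exact: measurableX.
- by apply: measurableI => //; exact: mBT.
- move=> z [/= Bz]; rewrite in_itv/= /G/= => Gr.
  have [Gf|] := boolP (G0 z \is a fin_num).
    by left; split => //; rewrite AG0/= -(fineK Gf) lte_fin.
  by rewrite fin_numE negb_and !negbK => /orP[/eqP ?|/eqP ?]; right; [right|left].
- move=> z [[/= Bz _]]; rewrite AG0/= => Gr.
  have [Gf|] := boolP (G0 z \is a fin_num).
    by left; split => //=; rewrite in_itv/= /G/= -lte_fin fineK.
  by rewrite fin_numE negb_and !negbK => /orP[/eqP ?|/eqP ?]; right; [right|left].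
Qed.

End transfer.

(** * Standard spaces as the real line up to null sets *)

Section standard_model.
Variable R : realType.

Lemma borel_lebesgueR (A : set R) :
  measurable A -> measurable (A : set (lebesgueR R)).
Proof. exact: sub_caratheodory. Qed.

(** Lebesgue measurable sets are those of the completion of the Borel sigma-algebra; this is how
    statements about [lebesgueR] return to Borel sets. *)
Lemma lebesgueR_decomp (D : set R) : measurable (D : set (lebesgueR R)) ->
  exists A N : set R, [/\ measurable A, measurable N,
    completed_lebesgue_measure N = 0, A `<=` D & D `<=` A `|` N].
Proof.
move=> mD; have : (completed_algebra_gen (@lebesgue_measure R)).-sigma.-measurable D.
  by rewrite completed_caratheodory_measurable.
rewrite g_sigma_completed_algebra_genE => -[A mA [N' [N [mN N0 N'N]] <-]].
by exists A, N; split => //; exact: setUS.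
Qed.

Lemma interval_atoms_null (i : interval R) (x : nat -> R)
    (p : nat -> {nonneg R}) (N : set R) : measurable N ->
  completed_lebesgue_measure N = 0 -> (forall n, ~ N (x n)) ->
  interval_atoms i x p N = 0.
Proof.
move=> mN N0 Nx; rewrite /interval_atoms.
have mN' := borel_lebesgueR mN.
apply: (etrans (measure_addE _ _ _)); rewrite /=.
rewrite [X in _ + X](_ : _ = 0) ?adde0.
  apply/eqP; rewrite -measure_le0 -N0; apply: le_measure; rewrite ?inE//.
  by apply: measurableI => //; exact: measurable_itv_lebesgueR.
rewrite /mseries eseries0// => n _ _.
transitivity ((p n)%:num%:E * (\1_N (x n))%:E) => //.
by rewrite indicE memNset ?mule0.
Qed.

Context d (T : measurableType d) (P : probability T R).

(** [Z] is the isomorphism mod 0 and [psi] its inverse. Images of measurable sets are only Lebesgue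
    measurable, so [psi] is Borel measurable only modulo sets that are null for the law of [Z]. *)
Lemma standard_model : standard_probability P ->
  exists (Z : T -> R) (psi : R -> T),
    [/\ measurable_fun setT Z, {ae P, forall w, psi (Z w) = w} &
      forall C, measurable C -> exists B N : set R,
        [/\ measurable B, measurable N, P (Z @^-1` N) = 0,
            psi @^-1` C `<=` B `|` N & B `<=` psi @^-1` C `|` N]].
Proof.
move=> [_ [i [x [p [_ [_ [A1 [A2 [phi
  [[mA1 A1c] [[mA2 A2c] [[phiA phi_inj phi_surj] [mphi [mimg muphi]]]]]]]]]]]]]].
(* Off the domain [A1] and the range [A2] of the isomorphism, [Z] takes the value 0 and [psi] the
   value [point]. *)
pose Z : T -> R := fun w => if w \in A1 then phi w else 0%R.
pose psi : R -> T := fun r => xget point [set w | A1 w /\ phi w = r].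
have psiK w : A1 w -> psi (phi w) = w.
  move=> A1w; rewrite /psi; case: xgetP => [y _ /= [A1y yw]|/(_ w)]; last first.
    by move=> /= nw; exfalso; apply: nw.
  by apply: phi_inj => //; rewrite ?inE.
have ZE w : A1 w -> Z w = phi w by move=> A1w; rewrite /Z mem_set.
have psiP r : A2 r -> A1 (psi r) /\ phi (psi r) = r.
  move=> /phi_surj[w A1w <-]; rewrite psiK//.
have mphiI (Y : set R) : measurable Y -> measurable (A1 `&` phi @^-1` Y).
  by move=> mY; apply: mphi => //; exact: borel_lebesgueR.
have mZ : measurable_fun setT Z.
  move=> _ Y mY; rewrite setTI.
  rewrite (_ : _ @^-1` _ = (A1 `&` phi @^-1` Y) `|` (~` A1 `&` [set w | Y 0%R])).
    apply: measurableU; first exact: mphiI.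
    apply: measurableI; first exact: measurableC.
    have [Y0|Y0] := pselect (Y 0%R).
      by rewrite (_ : [set _ | _] = setT)//; apply/seteqP; split.
    by rewrite (_ : [set _ | _] = set0)//; apply/seteqP; split.
  apply/seteqP; split=> w; rewrite /= /Z.
    by case: ifPn => [/set_mem ? ?|/negP nA ?]; [left|right; split => // ?; apply: nA; rewrite inE].
  by case: ifPn => [/set_mem ? [[]|[]]|/negP nA [[? ?]|[]]]//; case: nA; rewrite inE.
have mZp (Y : set R) : measurable Y -> measurable (Z @^-1` Y).
  by move=> mY; rewrite -[X in measurable X]setTI; exact: mZ.
have mX (Y : set R) : measurable (Y `&` range x).
  apply: countable_measurable => //; apply: sub_countable (card_image_le x setT).
  by apply: (card_le_trans (subset_card_le (@subIsetr _ _ _))); exact: card_lexx.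
have A1null (S : set T) : measurable S -> S `<=` ~` A1 -> P S = 0.
  move=> mS SA; apply/eqP; rewrite -measure_le0 -A1c le_measure ?inE//.
  exact: measurableC.
(* A Lebesgue null set may contain atoms. As the range of [x] is countable, the part of [D] in it
   can be put into the Borel set, and the range removed from the exceptional set. *)
have decomp (D : set R) : measurable (D : set (lebesgueR R)) ->
    exists B N : set R, [/\ measurable B, measurable N, P (Z @^-1` N) = 0,
      B `<=` D & D `<=` B `|` N].
  move=> /lebesgueR_decomp[A [N [mA mN N0 AD DAN]]].
  exists ((A `\` range x) `|` (D `&` range x)), (N `\` range x); split.
  - by apply: measurableU => //; apply: measurableD => //; rewrite -(setTI (range x)).
  - by apply: measurableD => //; rewrite -(setTI (range x)).
  - set N' := N `\` range x.
    have mN' : measurable N' by apply: measurableD => //; rewrite -(setTI (range x)).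
    have mNA : measurable (N' `&` A2 : set (lebesgueR R)).
      by apply: measurableI => //; exact: borel_lebesgueR.
    have NA0 : interval_atoms i x p (N' `&` A2) = 0.
      apply/eqP; rewrite -measure_le0.
      rewrite -(@interval_atoms_null i x p N')//; first last.
      + by move=> n [_]; apply; exists n.
      + apply/eqP; rewrite -measure_le0 -N0; apply: le_measure => [||r []//].
        * by rewrite inE; exact: borel_lebesgueR.
        * by rewrite inE; exact: borel_lebesgueR.
      by apply: le_measure => [||r []//]; rewrite inE//; exact: borel_lebesgueR.
    apply/negligibleP; first exact: mZp.
    apply: (@negligibleS _ _ _ _ ((A1 `&` phi @^-1` (N' `&` A2)) `|` ~` A1)).
      move=> w /= Nw; have [A1w|] := pselect (A1 w); last by right.
      by left; split => //; rewrite -ZE//; split => //; rewrite ZE//; exact: phiA.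
    apply: negligibleU; last by apply/negligibleP => //; exact: measurableC.
    apply/negligibleP; first by apply: mphi.
    by apply: etrans (muphi _ mNA _) NA0; exact: subIsetr.
  - by move=> r [[/AD//]|[]].
  - move=> r Dr; have [xr|nxr] := pselect (range x r); first by left; right.
    by have [Ar|Nr] := DAN _ Dr; [left; left|right].
exists Z, psi; split => //.
  apply: (@negligibleS _ _ _ _ (~` A1)); last first.
    by apply/negligibleP => //; exact: measurableC.
  by apply: subsetC => w A1w /=; rewrite ZE// psiK.
move=> C mC.
(* Within [A2] the preimage of [C] under [psi] is this image; the complement of [A2] goes into the
   exceptional set, as [Z] maps almost every point into [A2]. *)
have mD : measurable (phi @` (A1 `&` C) : set (lebesgueR R)).
  by apply: mimg; [exact: measurableI|exact: subIsetl].
have [B [N [mB mN N0 BD DBN]]] := decomp _ mD.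
have [B' [N' [mB' mN' N'0 B'D DB'N]]] := decomp _ (measurableC mA2).
exists B, (N `|` (B' `|` N')); split => //.
- by apply: measurableU => //; exact: measurableU.
- apply/negligibleP; first by apply: mZp; apply: measurableU => //; exact: measurableU.
  rewrite !preimage_setU; apply: negligibleU; last apply: negligibleU.
  + by apply/negligibleP => //; exact: mZp.
  + apply/negligibleP; first exact: mZp.
    apply: A1null; first exact: mZp.
    move=> w /= /B'D nA2 A1w; apply: nA2; rewrite ZE//; exact: phiA.
  + by apply/negligibleP => //; exact: mZp.
- move=> r /= Cr; have [A2r|nA2r] := pselect (A2 r); last first.
    by right; right; exact: DB'N.
  have [A1p pr] := psiP _ A2r.
  have [|Br|Nr] := DBN r; [by exists (psi r)|by left|by right; left].
- by move=> r /BD[w [A1w Cw] <-]; left; rewrite /= psiK.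
Qed.

End standard_model.

(** * Maps measurable up to null sets, and image laws *)

Section completion.
Context (R : realType).

Lemma measurable_preimage d d' (X : measurableType d) (Y : measurableType d')
    (h : X -> Y) A : measurable_fun setT h -> measurable A ->
  measurable (h @^-1` A).
Proof. by move=> mh mA; rewrite -[X in measurable X]setTI; exact: mh. Qed.

Lemma negligible_preimage d d' (X : measurableType d) (Y : measurableType d')
    (m : {measure set X -> \bar R}) (m' : {measure set Y -> \bar R})
    (h : X -> Y) N : measurable_fun setT h ->
  (forall A, measurable A -> m' A = m (h @^-1` A)) ->
  m'.-negligible N -> m.-negligible (h @^-1` N).
Proof.
move=> mh hE [A [mA A0 NA]]; exists (h @^-1` A); split.
- exact: measurable_preimage.
- by rewrite -hE.
- by move=> x /NA.
Qed.

Lemma complete_measurable d (X : measurableType d)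
    (m : {measure set X -> \bar R}) A S N :
  measure_is_complete m -> measurable A -> m.-negligible N ->
  S `<=` A `|` N -> A `<=` S `|` N -> measurable S.
Proof.
move=> cm mA mN SA AS.
have -> : S = (A `\` (A `\` S)) `|` (S `\` A).
  apply/seteqP; split=> x.
    by move=> Sx; have [Ax|nAx] := pselect (A x); [left; split => // -[]|right].
  by move=> [[Ax nAS]|[]//]; apply: contrapT => nSx; apply: nAS.
apply: measurableU; last first.
  by apply: cm; apply: negligibleS mN => x [/SA[|]].
apply: measurableD => //; apply: cm; apply: negligibleS mN => x [/AS[|]//].
Qed.

(** Measurability of the preimage of [S] for the completion of [m], expressed within the original
    sigma-algebra. *)
Definition measurable_mod d d' (X : measurableType d) (Y : measurableType d')
    (m : set X -> \bar R) (h : X -> Y) (S : set Y) :=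
  exists A N : set X, [/\ measurable A, m.-negligible N,
    h @^-1` S `<=` A `|` N & A `<=` h @^-1` S `|` N].

(* The image under [h] of the Caratheodory completion of [m]. *)
Lemma completed_pushforward d d' (X : measurableType d) (Y : measurableType d')
    (m : {measure set X -> \bar R}) (h : X -> Y) :
  (forall S, measurable S -> measurable_mod m h S) ->
  exists J : {measure set Y -> \bar R}, forall S A N,
    measurable S -> measurable A -> m.-negligible N ->
    h @^-1` S `<=` A `|` N -> A `<=` h @^-1` S `|` N -> J S = m A.
Proof.
move=> hmod.
pose I : measurableType _ := caratheodory_type (m^*)%mu.
pose c : {measure set I -> \bar R} := @completed_measure_extension _ _ _ m.
have mI (A : set X) : measurable A -> measurable (A : set I).
  exact: caratheodory_measurable_mu_ext.
have cE (A : set X) : measurable A -> c A = m A by exact: measurable_mu_extE.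
have cneg (N : set X) : m.-negligible N -> c.-negligible N.
  move=> [N' [mN' N'0 NN']]; exists N'; split => //; first exact: mI.
  by rewrite cE.
have hI S : measurable S -> measurable (h @^-1` S : set I).
  move=> /hmod[A [N [mA nN SA AS]]].
  apply: (complete_measurable (m := c)) (mI _ mA) (cneg _ nN) SA AS.
  exact: measure_is_complete_caratheodory.
have mh : measurable_fun setT (h : I -> Y).
  by move=> _ S mS; rewrite setTI; exact: hI.
have [J JE] := measure_pushforward c mh.
exists J => S A N mS mA nN SA AS; rewrite JE -cE//.
by apply: (measure_eq_mod _ _ (cneg _ nN)) => //; [exact: hI|exact: mI].
Qed.

(** The sets with this property form a sigma-algebra, so rectangles are enough; for these the
    exceptional set is a cylinder over a null set of the second marginal. *)
Lemma measurable_mod_prod d1 d2 (T1 : measurableType d1) (T2 : measurableType d2)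
    (m : {measure set (T1 * R)%type -> \bar R}) (psi : R -> T2) :
  (forall C, measurable C -> exists B N : set R,
        [/\ measurable B, measurable N, m (snd @^-1` N) = 0,
            psi @^-1` C `<=` B `|` N & B `<=` psi @^-1` C `|` N]) ->
  forall S, measurable S -> measurable_mod m (fun z => (z.1, psi z.2)) S.
Proof.
move=> hpsi; pose h (z : T1 * R) := (z.1, psi z.2).
suff : @measurable _ (T1 * T2)%type `<=` measurable_mod m h by apply.
rewrite measurable_prod_measurableType; apply: smallest_sub.
  split.
  - exists set0, set0; split => //; exact: negligible_set0.
  - move=> S [A [N [mA nN SA AS]]]; exists (~` A), N; split => //.
    + exact: measurableC.
    + move=> z [_ nSz]; have [Az|] := pselect (A z); last by left.
      by case: (AS _ Az) => // Nz; right.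
    + move=> z nAz; have [Sz|] := pselect ((h @^-1` S) z); last by left; split.
      by case: (SA _ Sz) => // Nz; right.
  - move=> F mF.
    have [A AP] := choice mF; have [N NP] := choice AP.
    exists (\bigcup_n A n), (\bigcup_n N n); split.
    + by apply: bigcupT_measurable => n; have [] := NP n.
    + by apply: negligible_bigcup => n; have [] := NP n.
    + move=> z [n _ Fz]; have [_ _ /(_ _ Fz)[Az|Nz] _] := NP n.
        by left; exists n.
      by right; exists n.
    + move=> z [n _ Az]; have [_ _ _ /(_ _ Az)[Fz|Nz]] := NP n.
        by left; exists n.
      by right; exists n.
move=> _ [D mD [C mC <-]].
have [B [N [mB mN N0 CB BC]]] := hpsi _ mC.
exists (D `*` B), (snd @^-1` N); split.
- exact: measurableX.
- by apply/negligibleP => //; apply: measurable_preimage => //; exact: measurable_snd.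
- by move=> z [/= Dz /CB[Bz|Nz]]; [left|right].
- by move=> z [/= Dz /BC[Cz|Nz]]; [left|right].
Qed.

Lemma law_exists d d' (X : measurableType d) (Y : measurableType d')
    (P : probability X R) (h : X -> Y) : measurable_fun setT h ->
  exists L : probability Y R, forall A, L A = P (h @^-1` A).
Proof.
move=> mh; have [m mE] := measure_pushforward P mh.
have [|L LE] := @probabilityW _ _ _ m; first by rewrite mE preimage_setT; exact: probability_setT.
by exists L => A; rewrite LE mE.
Qed.

(** [transfer] is applied to the law of [xi]: the map that sends [(x, u)] to [(xi x, u)] takes the
    product of [P] and [U] to the product of that law and [U]. *)
Lemma transfer_rv d d' (X : measurableType d) (Y : measurableType d')
    (P : probability X R) (U : probability R R) (xi : X -> Y)
    (M : probability (Y * R)%type R) :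
  (forall c : R, (0 <= c <= 1)%R -> U `]-oo, c[%classic = c%:E) ->
  measurable_fun setT xi ->
  (forall A, measurable A -> M (fst @^-1` A) = P (xi @^-1` A)) ->
  exists G : Y * R -> R, measurable_fun setT G /\
    forall S, measurable S ->
      (P \x U) ((fun z => (xi z.1, G (xi z.1, z.2))) @^-1` S) = M S.
Proof.
move=> UE mxi Mfst.
have [m mE] := law_exists P mxi.
have [|G [mG GE]] := @transfer _ _ _ m U M UE.
  by move=> A mA; rewrite mE Mfst.
exists G; split => // S mS; rewrite -GE//.
have mh : measurable_fun setT (fun z : X * R => (xi z.1, z.2)).
  apply: measurable_fun_pair; last exact: measurable_snd.
  by apply: (measurableT_comp mxi); exact: measurable_fst.
have [m' m'E] := law_exists (P \x U) mh.
rewrite -[LHS](m'E ((fun z => (z.1, G z)) @^-1` S)).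
apply/esym/product_measure_unique; last first.
  by apply: measurable_preimage => //; apply: measurable_fun_pair => //; exact: measurable_fst.
move=> A B mA mB; transitivity (P (xi @^-1` A) * U B); last first.
  congr (_ * _). exact: esym (mE A).
rewrite -[RHS](product_measure1E P U (measurable_preimage mxi mA) mB).
apply: etrans (m'E _) _.
by congr ((P \x U) _); apply/seteqP; split=> [[x u] []|[x u] []].
Qed.

End completion.

(** * From the coupling on the line to a coupling of the two spaces *)

Theorem proposition5p3 (R : realType) (d1 d2 : measure_display)
    (T1 : measurableType d1) (T2 : measurableType d2)
    (P1 : probability T1 R) (P2 : probability T2 R)
    (hP1 : standard_probability P1) (hP2 : standard_probability P2)
    (f : T1 -> RmodQ R) (g : T2 -> RmodQ R)
    (hf : strong_rv P1 f) (hg : strong_rv P2 g)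
    (hfg : weakly_identically_distributed P1 P2 f g) :
  strongly_identically_distributed P1 P2 f g.
Proof.
have [X [mX fX]] := hf; have [Y [mY gY]] := hg.
have [mu muE] := law_exists P1 mX; have [nu nuE] := law_exists P2 mY.
(* As [k] is the class of [W] only almost everywhere, measurability of the event on [k] comes from
   completeness. Invariance of [A] makes membership depend only on the class. *)
have lawE d (T : measurableType d) (P : probability T R) (W : T -> R)
    (k : T -> RmodQ R) (A : set R) : measure_is_complete P ->
    measurable_fun setT W -> {ae P, forall w, k w = piQ (W w)} ->
    measurable A -> (forall (q : rat) x, A x -> A (x + ratr q)%R) ->
    P (k @^-1` (@piQ R @` A)) = P (W @^-1` A).
  move=> cP mW kW mA Ainv.
  have mWA := measurable_preimage mW mA.
  pose N := ~` [set w | k w = piQ (W w)].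
  have kA : k @^-1` (@piQ R @` A) `<=` W @^-1` A `|` N.
    move=> w [x Ax xw]; have [kw|] := pselect (k w = piQ (W w)); last by right.
    left; move: xw; rewrite kw => /esym/piQP[q Wq] /=.
    by rewrite -(subrK x (W w)) Wq addrC; exact: Ainv.
  have Ak : W @^-1` A `<=` k @^-1` (@piQ R @` A) `|` N.
    move=> w Aw; have [kw|] := pselect (k w = piQ (W w)); last by right.
    by left; exists (W w).
  apply: (measure_eq_mod _ mWA kW kA Ak).
  exact: (complete_measurable cP mWA kW kA Ak).
(* The weak hypothesis is applied to the image of [A] in the quotient, whose preimage is [A] itself
   by invariance. *)
have munu (A : set R) : measurable A ->
    (forall (q : rat) x, A x -> A (x + ratr q)%R) -> mu A = nu A.
  move=> mA Ainv; rewrite muE nuE.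
  rewrite -(lawE _ _ _ _ _ _ hP1.1 mX fX mA Ainv).
  rewrite -(lawE _ _ _ _ _ _ hP2.1 mY gY mA Ainv).
  apply: hfg; rewrite (_ : _ @^-1` _ = A)//.
  apply/seteqP; split=> x; last by exists x.
  by move=> [y Ay /esym/piQP[q xyq]]; rewrite -(subrK y x) xyq addrC; exact: Ainv.
have [M [M1 M2 Mae]] := rational_coupling munu.
have [Z [psi [mZ psiZ hpsi]]] := standard_model hP2.
have [U UE] := uniform_law R.
have mYZ : measurable_fun setT (fun w => (Y w, Z w)) by exact: measurable_fun_pair.
have [L LE] := law_exists P2 mYZ.
(* With [v] uniform and independent of [w], the pair [(X w, H (X w, v))] has law [M]. *)
have [|H [mH HE]] := @transfer_rv _ _ _ _ _ P1 U X M UE mX.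
  by move=> A mA; rewrite M1// muE.
pose V1 : probability (T1 * R)%type R := P1 \x U.
pose Y' (z : T1 * R) := H (X z.1, z.2).
have mXv : measurable_fun setT (fun z : T1 * R => (X z.1, z.2)).
  apply: measurable_fun_pair; last exact: measurable_snd.
  by apply: (measurableT_comp mX); exact: measurable_fst.
have mY' : measurable_fun setT Y' by exact: measurableT_comp mH mXv.
(* The law of [Y'] is [nu], the first marginal of [L], so a further uniform variable completes [Y']
   to a pair with law [L]. *)
have [|G [mG GE]] := @transfer_rv _ _ _ _ _ V1 U Y' L UE mY'.
  move=> A mA; rewrite LE.
  transitivity (nu A); first by rewrite nuE.
  rewrite -M2// -HE; last by apply: measurable_preimage => //; exact: measurable_snd.
  by [].
pose V : probability ((T1 * R) * R)%type R := V1 \x U.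
pose Z' (z : (T1 * R) * R) := G (Y' z.1, z.2).
have mYu : measurable_fun setT (fun z : (T1 * R) * R => (Y' z.1, z.2)).
  apply: measurable_fun_pair; last exact: measurable_snd.
  by apply: (measurableT_comp mY'); exact: measurable_fst.
have mZ' : measurable_fun setT Z' by exact: measurableT_comp mG mYu.
have mYZ' : measurable_fun setT (fun z : (T1 * R) * R => (Y' z.1, Z' z)).
  by apply: measurable_fun_pair => //; apply: (measurableT_comp mY'); exact: measurable_fst.
pose phi (z : (T1 * R) * R) := (z.1.1, Z' z).
have mphi : measurable_fun setT phi.
  apply: measurable_fun_pair => //.
  by apply: (measurableT_comp measurable_fst); exact: measurable_fst.
(* [K] couples the first space with the model of the second one: its marginals are [P1] and the law
   of [Z]. *)
have [K KE] := law_exists V mphi.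
have VL A : measurable A -> L A = V ((fun z => (Y' z.1, Z' z)) @^-1` A).
  by move=> mA; rewrite -GE.
have V1M A : measurable A -> M A = V1 ((fun z => (X z.1, Y' z)) @^-1` A).
  by move=> mA; rewrite -HE.
have V1E A : measurable A -> V (fst @^-1` A) = V1 A.
  move=> mA; rewrite (_ : fst @^-1` A = A `*` setT); last first.
    by apply/seteqP; split=> z //= -[].
  apply: etrans (product_measure1E _ _ mA measurableT) _.
  by rewrite [X in _ * X](_ : _ = 1) ?mule1//; exact: probability_setT.
have K1 A : measurable A -> K (fst @^-1` A) = P1 A.
  move=> mA; rewrite KE.
  rewrite (_ : _ @^-1` _ = fst @^-1` (A `*` [set: R])); last first.
    by apply/seteqP; split=> [z Az|z []//]; split.
  rewrite V1E; last exact: measurableX.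
  apply: etrans (product_measure1E _ _ mA measurableT) _.
  by rewrite [X in _ * X](_ : _ = 1) ?mule1//; exact: probability_setT.
have L2 A : measurable A -> L (snd @^-1` A) = P2 (Z @^-1` A) by move=> mA; rewrite LE.
have K2 A : measurable A -> K (snd @^-1` A) = P2 (Z @^-1` A).
  move=> mA; rewrite KE -L2// VL//.
  by apply: measurable_preimage => //; exact: measurable_snd.
(* Both [K] and [L] have the law of [Z] as second marginal, so the exceptional sets of [psi] are
   null for both. *)
have modK : forall S, measurable S -> measurable_mod K (fun z : T1 * R => (z.1, psi z.2)) S.
  apply: measurable_mod_prod => C /hpsi[B [N [mB mN N0 CB BC]]].
  by exists B, N; split => //; apply: etrans (K2 _ mN) N0.
have modL : forall S, measurable S -> measurable_mod L (fun z : R * R => (z.1, psi z.2)) S.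
  apply: measurable_mod_prod => C /hpsi[B [N [mB mN N0 CB BC]]].
  by exists B, N; split => //; apply: etrans (L2 _ mN) N0.
have [J0 J0E] := completed_pushforward modK.
have J0T : J0 setT = 1.
  transitivity (K setT); last exact: probability_setT.
  by apply: (J0E _ _ set0) => //; exact: negligible_set0.
have [J JE] := probabilityW J0T.
have J1 A : measurable A -> J (fst @^-1` A) = P1 A.
  move=> mA; rewrite JE -K1//.
  apply: (J0E _ _ set0); rewrite ?setU0//.
  + by apply: measurable_preimage => //; exact: measurable_fst.
  + by apply: measurable_preimage => //; exact: measurable_fst.
  + exact: negligible_set0.
have J2 C : measurable C -> J (snd @^-1` C) = P2 C.
  move=> mC; have [B [N [mB mN N0 CB BC]]] := hpsi _ mC.
  transitivity (P2 (Z @^-1` B)).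
    rewrite JE -K2//; apply: (J0E _ _ (snd @^-1` N)).
    + by apply: measurable_preimage => //; exact: measurable_snd.
    + by apply: measurable_preimage => //; exact: measurable_snd.
    + apply/negligibleP; first by apply: measurable_preimage => //; exact: measurable_snd.
      exact: etrans (K2 _ mN) N0.
    + by move=> z /= /CB.
    + by move=> z /= /BC.
  (* Since [psi (Z w) = w] almost everywhere, [C] agrees up to null sets with the event that [Z]
     lies in [B]. *)
  apply: (@measure_eq_mod _ _ _ _ _ _ (Z @^-1` N `|` ~` [set w | psi (Z w) = w])) => //.
  + exact: measurable_preimage.
  + apply: negligibleU => //; apply/negligibleP => //; exact: measurable_preimage.
  + move=> w /= /BC[/=|Nw]; last by right; left.
    by have [->|] := pselect (psi (Z w) = w); [left|right; right].
  + move=> w Cw; have [pw|] := pselect (psi (Z w) = w); last by right; right.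
    by have [|Bw|Nw] := CB (Z w); [rewrite /= pw|left|right; left].
pose D := [set z : T1 * T2 | exists q : rat, (X z.1 - Y z.2)%R = ratr q].
have mD : measurable D.
  have mXY : measurable_fun setT (fun z : T1 * T2 => (X z.1, Y z.2)).
    apply: measurable_fun_pair.
      by apply: (measurableT_comp mX); exact: measurable_fst.
    by apply: (measurableT_comp mY); exact: measurable_snd.
  by have := measurable_preimage mXY (@measurable_rat_diff R).
(* Under the law [L] of [(Y, Z)] the second coordinate determines the first through [psi]. This
   passes to [(Y', Z')]: almost surely [Y'] is [Y] at the point [psi Z']. *)
have Lneg : L.-negligible [set z | z.1 <> Y (psi z.2)].
  pose S := [set z : R * T2 | z.1 <> Y z.2].
  have mS : measurable S.
    have mYw : measurable_fun setT (fun z : R * T2 => (z.1 - Y z.2)%R).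
      apply: measurable_funB; first exact: measurable_fst.
      by apply: (measurableT_comp mY); exact: measurable_snd.
    have := measurable_preimage mYw (measurableC (measurable_set1 (0%R : R))).
    congr measurable; apply/seteqP; split=> z /= + zY; apply.
      by rewrite zY subrr.
    by apply/eqP; rewrite -subr_eq0 zY.
  have [A [N [mA nN SA AS]]] := modL _ mS.
  apply: (negligibleS SA); apply: negligibleU => //.
  apply/negligibleP => //; apply: (etrans (LE _)).
  apply/negligibleP; first exact: measurable_preimage.
  apply: (@negligibleS _ _ _ _
    (~` [set w | psi (Z w) = w] `|` (fun w => (Y w, Z w)) @^-1` N)).
    move=> w /AS[/= YZ|Nw]; last by right.
    by left=> /= pw; apply: YZ; rewrite pw.
  apply: negligibleU => //; apply: negligible_preimage nN => //.
  by move=> B mB; exact: LE.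
have JD : J.-negligible (~` D).
  have [A [N [mA nN SA AS]]] := modK _ (measurableC mD).
  apply/negligibleP; first exact: measurableC.
  rewrite [LHS]JE (J0E _ A N)//; last exact: measurableC.
  apply: (etrans (KE _)); apply/negligibleP; first exact: measurable_preimage.
  (* Three null events cover the failure: [X - Y'] is irrational, null by [M]; [Y'] differs from [Y]
     at [psi Z'], null by [L]; the exceptional set [N] is met, null by [K]. *)
  apply: (@negligibleS _ _ _ _
    ((fst @^-1` ((fun z => (X z.1, Y' z)) @^-1`
        ~` [set z | exists q : rat, (z.1 - z.2)%R = ratr q])) `|`
     ((fun z => (Y' z.1, Z' z)) @^-1` [set z | z.1 <> Y (psi z.2)]) `|`
     (phi @^-1` N))).
    move=> z /AS[/= nDz|]; last by right.
    left; have [Yz|] := pselect (Y' z.1 = Y (psi (Z' z))); last by right.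
    by left=> /= -[q]; rewrite Yz => XY; apply: nDz; exists q.
  apply: negligibleU; first apply: negligibleU.
  - apply: (@negligible_preimage _ _ _ _ _ V V1); first exact: measurable_fst.
      by move=> B mB; exact/esym/V1E.
    apply: (@negligible_preimage _ _ _ _ _ V1 M) => //.
    apply: measurable_fun_pair => //.
    by apply: (measurableT_comp mX); exact: measurable_fst.
  - exact: (@negligible_preimage _ _ _ _ _ V L).
  - by apply: (@negligible_preimage _ _ _ _ _ V K) => // B mB; exact: KE.
exists J; split => //.
(* Off these null events [f] and [g] are the classes of [X] and [Y], which differ by a rational. *)
apply: (@negligibleS _ _ _ _ (fst @^-1` (~` [set w | f w = piQ (X w)]) `|`
  snd @^-1` (~` [set w | g w = piQ (Y w)]) `|` ~` D)).
  move=> w /= fg.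
  have [fw|] := pselect (f w.1 = piQ (X w.1)); last by left; left.
  have [gw|] := pselect (g w.2 = piQ (Y w.2)); last by left; right.
  by right=> Dw; apply: fg; rewrite fw gw; exact/piQP.
apply: negligibleU => //; apply: negligibleU.
- by apply: (@negligible_preimage _ _ _ _ _ J P1); [exact: measurable_fst|move=> A /J1|].
- by apply: (@negligible_preimage _ _ _ _ _ J P2); [exact: measurable_snd|move=> A /J2|].
Qed.
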